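(* Let $d\ge1$ and $n\ge3$ be integers. Let $\Sigma_{d,n}$ be the set of all words $$t_1^{a_1}\cdots t_n^{a_n}\,(g_{i_1}g_{i_1-1}\cdots g_{i_1-k_1})(g_{i_2}g_{i_2-1}\cdots g_{i_2-k_2})\cdots(g_{i_p}g_{i_p-1}\cdots g_{i_p-k_p})$$ in ${\rm YTL}_{d,n}(u)$, where $p\ge0$ and $k_j\ge0$ are integers, $a_1,\dots,a_n\in\mathbb{Z}/d\mathbb{Z}$, $1\le i_1<i_2<\cdots<i_p\le n-1$ and $1\le i_1-k_1<i_2-k_2<\cdots<i_p-k_p$. Then $\Sigma_{d,n}$ spans ${\rm YTL}_{d,n}(u)$ as a $K$-vector space. Moreover, in a word of $\Sigma_{d,n}$ (with $p\ge1$) the highest index generator is $g_{i_p}$, in the rightmost cycle, and the lowest index generator is $g_{i_1-k_1}$, in the leftmost cycle.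
   Context: Let $u$ be an indeterminate and $K=\mathbb{C}(u)$; algebras are associative unital $K$-algebras. Each factor $(g_{i_j}g_{i_j-1}\cdots g_{i_j-k_j})$ (decreasing consecutive indices) is called a cycle. The Yokonuma--Hecke algebra ${\rm Y}_{d,n}(u)$ is the $K$-algebra generated by $g_1,\dots,g_{n-1},t_1,\dots,t_n$ subject to: $g_ig_j=g_jg_i$ for $|i-j|>1$; $g_{i+1}g_ig_{i+1}=g_ig_{i+1}g_i$; $g_i^2=1+(u-1)e_i+(u-1)e_ig_i$; $t_it_j=t_jt_i$ for all $i,j$; $t_i^d=1$; $g_it_i=t_{i+1}g_i$; $g_it_{i+1}=t_ig_i$; $g_it_j=t_jg_i$ for $j\ne i,i+1$; where $e_i:=\frac1d\sum_{s=0}^{d-1}t_i^st_{i+1}^{-s}$. For $|i-j|=1$ put $g_{i,j}:=1+g_i+g_j+g_ig_j+g_jg_i+g_ig_jg_i$. For $n\ge3$, the Yokonuma--Temperley--Lieb algebra is ${\rm YTL}_{d,n}(u):={\rm Y}_{d,n}(u)/I$, where $I$ is the two-sided ideal generated by all $g_{i,j}$ with $|i-j|=1$. The images of $g_i,t_j$ in the quotient are denoted by the same symbols. *)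

(* Defs.v *)
From HB Require Import structures.
From mathcomp Require Import all_boot all_order all_algebra.
From mathcomp Require Import boolp reals.
From mathcomp Require Import complex.
From mathcomp Require Import monalg.

Set Implicit Arguments.
Unset Strict Implicit.
Unset Printing Implicit Defensive.

Import GRing.Theory.
Local Open Scope ring_scope.
Local Open Scope quotient_scope.

(* MathComp only has ring quotients of commutative rings. We complete its
   proper left ideals [idealr] into proper two-sided ideals of a possibly
   noncommutative ring, and make the quotient of a K-algebra a K-algebra. *)
HB.mixin Record isRightStable (R : nzRingType) (S : R -> bool) := {
  right_stable_subproof : forall a, {in S, forall x, x * a \in S}
}.

#[short(type="idealT")]
HB.structure Definition IdealT (R : nzRingType) :=
  {S of Idealr R S & isRightStable R S}.

Section AlgQuotientDef.
Context (K : comNzRingType) (A : algType K) (I : idealT A).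

Definition algquot : Type := {ideal_quot I}.
HB.instance Definition _ := GRing.Zmodule.on algquot.
End AlgQuotientDef.

HB.lock Definition algpi (K : comNzRingType) (A : algType K) (I : idealT A)
  (x : A) : algquot I := \pi_({ideal_quot I}) x.
HB.lock Definition algrepr (K : comNzRingType) (A : algType K) (I : idealT A)
  (q : algquot I) : A := repr (q : {ideal_quot I}).

HB.lock Definition algquot_scale (K : comNzRingType) (A : algType K)
  (I : idealT A) (c : K) (x : algquot I) : algquot I :=
  algpi I (c *: algrepr x).

Section AlgQuotient.
Context (K : comNzRingType) (A : algType K) (I : idealT A).

Local Notation algquot := (algquot I).
Local Notation algpi := (@algpi K A I).
Local Notation algrepr := (@algrepr K A I).
Local Notation algquot_scale := (@algquot_scale K A I).

Lemma algreprK : cancel algrepr algpi.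
Proof. by move=> x; rewrite algpi.unlock algrepr.unlock; apply: reprK. Qed.

Lemma algpiP (x y : A) : algpi x = algpi y <-> x - y \in I.
Proof. by rewrite algpi.unlock Quotient.idealrBE; split=> /eqP. Qed.

Lemma algrepr_pi (x : A) : algrepr (algpi x) - x \in I.
Proof. by apply/algpiP; rewrite algreprK. Qed.

Lemma algpi_is_zmod_morphism : zmod_morphism algpi.
Proof. by rewrite algpi.unlock; apply: (raddfB (\pi_({ideal_quot I}))). Qed.
HB.instance Definition _ :=
  GRing.isZmodMorphism.Build A algquot algpi algpi_is_zmod_morphism.

Definition algquot_one : algquot := algpi 1.
Definition algquot_mul (x y : algquot) : algquot :=
  algpi (algrepr x * algrepr y).

Let piM x y : algquot_mul (algpi x) (algpi y) = algpi (x * y).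
Proof.
apply/algpiP; set x' := algrepr _; set y' := algrepr _.
rewrite (_ : _ - _ = x' * (y' - y) + (x' - x) * y); last first.
  by rewrite mulrBr mulrBl addrA subrK.
apply: rpredD; first exact/idealMr/algrepr_pi.
exact/right_stable_subproof/algrepr_pi.
Qed.

Let piZ c x : algquot_scale c (algpi x) = algpi (c *: x).
Proof.
rewrite algquot_scale.unlock; apply/algpiP; rewrite -scalerBr -mulr_algl; exact/idealMr/algrepr_pi.
Qed.

Let mulA : associative algquot_mul.
Proof.
move=> x y z; rewrite -[x]algreprK -[y]algreprK -[z]algreprK.
by rewrite !piM mulrA.
Qed.
Let mul1 : left_id algquot_one algquot_mul.
Proof. by move=> x; rewrite -[x]algreprK piM mul1r. Qed.
Let mulx1 : right_id algquot_one algquot_mul.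
Proof. by move=> x; rewrite -[x]algreprK piM mulr1. Qed.
Let mulDl : left_distributive algquot_mul +%R.
Proof.
move=> x y z; rewrite -[x]algreprK -[y]algreprK -[z]algreprK.
by rewrite -raddfD !piM -raddfD mulrDl.
Qed.
Let mulDr : right_distributive algquot_mul +%R.
Proof.
move=> x y z; rewrite -[x]algreprK -[y]algreprK -[z]algreprK.
by rewrite -raddfD !piM -raddfD mulrDr.
Qed.
Let one_neq0 : algquot_one != 0.
Proof.
apply/eqP; rewrite -(raddf0 algpi) => /algpiP.
by rewrite subr0 idealr1.
Qed.
HB.instance Definition _ := GRing.Zmodule_isNzRing.Build algquot
  mulA mul1 mulx1 mulDl mulDr one_neq0.

Let scaleA c d x : 
  algquot_scale c (algquot_scale d x) = algquot_scale (c * d) x.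
Proof. by rewrite -[x]algreprK !piZ scalerA. Qed.
Let scale1 : left_id 1 algquot_scale.
Proof. by move=> x; rewrite -[x]algreprK piZ scale1r. Qed.
Let scaleDr : right_distributive algquot_scale +%R.
Proof.
move=> c x y; rewrite -[x]algreprK -[y]algreprK.
by rewrite -raddfD !piZ -raddfD scalerDr.
Qed.
Let scaleDl x : {morph algquot_scale^~ x : c d / c + d}.
Proof. by move=> c d; rewrite -[x]algreprK !piZ -raddfD scalerDl. Qed.
HB.instance Definition _ := GRing.Zmodule_isLmodule.Build K algquot
  scaleA scale1 scaleDr scaleDl.

Let scaleAl (c : K) (x y : algquot) : c *: (x * y) = (c *: x) * y.
Proof.
rewrite -[x]algreprK -[y]algreprK.
by rewrite /GRing.scale /GRing.mul /= !(piM, piZ) scalerAl.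
Qed.
HB.instance Definition _ := GRing.Lmodule_isLalgebra.Build K algquot scaleAl.

Let scaleAr (c : K) (x y : algquot) : c *: (x * y) = x * (c *: y).
Proof.
rewrite -[x]algreprK -[y]algreprK.
by rewrite /GRing.scale /GRing.mul /= !(piM, piZ) scalerAr.
Qed.
HB.instance Definition _ := GRing.Lalgebra_isAlgebra.Build K algquot scaleAr.

Lemma algpi_is_monoid_morphism : monoid_morphism algpi.
Proof. by split=> // x y; rewrite [RHS]piM. Qed.
HB.instance Definition _ :=
  GRing.isMonoidMorphism.Build A algquot algpi algpi_is_monoid_morphism.

Lemma algpi_is_scalable : scalable algpi.
Proof. by move=> c x; rewrite [RHS]piZ. Qed.
HB.instance Definition _ :=
  GRing.isScalable.Build K A algquot *:%R algpi algpi_is_scalable.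

Section Lift.
Context (T : nzRingType) (f : {rmorphism A -> T}).

Definition algquot_lift (fI : {in I, forall x, f x = 0}) (q : algquot) : T :=
  f (algrepr q).

Context (fI : {in I, forall x, f x = 0}).

Lemma algquot_lift_pi x : algquot_lift fI (algpi x) = f x.
Proof. by apply/eqP; rewrite -subr_eq0 -rmorphB fI ?algrepr_pi. Qed.

Lemma algquot_lift_is_zmod_morphism : zmod_morphism (algquot_lift fI).
Proof.
move=> x y; rewrite -[x]algreprK -[y]algreprK.
by rewrite -raddfB !algquot_lift_pi rmorphB.
Qed.
Lemma algquot_lift_is_monoid_morphism : monoid_morphism (algquot_lift fI).
Proof.
split=> [|x y]; first by rewrite algquot_lift_pi rmorph1.
rewrite -[x]algreprK -[y]algreprK.
by rewrite -rmorphM !algquot_lift_pi rmorphM.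
Qed.
HB.instance Definition _ := GRing.isZmodMorphism.Build algquot T
  (algquot_lift fI) algquot_lift_is_zmod_morphism.
HB.instance Definition _ := GRing.isMonoidMorphism.Build algquot T
  (algquot_lift fI) algquot_lift_is_monoid_morphism.
End Lift.

End AlgQuotient.

Section GeneratedIdeal.
Context (R : nzRingType).

Inductive ideal_gen (S : R -> Prop) : R -> Prop :=
| IdealGen x : S x -> ideal_gen S x
| Ideal0 : ideal_gen S 0
| IdealD x y : ideal_gen S x -> ideal_gen S y -> ideal_gen S (x + y)
| IdealMl a x : ideal_gen S x -> ideal_gen S (a * x)
| IdealMr x a : ideal_gen S x -> ideal_gen S (x * a).

Lemma ideal_gen_idealr (S : R -> Prop) : ~ ideal_gen S 1 ->
  idealr_closed (fun x => `[< ideal_gen S x >]).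
Proof.
move=> S1; split; first exact/asboolP/Ideal0.
  by apply/negP => /asboolP.
move=> a x y /asboolP Sx /asboolP Sy; apply/asboolP.
exact/IdealD/Sy/IdealMl.
Qed.

Lemma ideal_gen_right (S : R -> Prop) (a : R) :
  {in (fun x => `[< ideal_gen S x >]), forall x,
    x * a \in (fun x => `[< ideal_gen S x >])}.
Proof. by move=> x /asboolP Sx; apply/asboolP/IdealMr. Qed.

(* A ring morphism killing S witnesses that the ideal of S is proper. *)
Lemma ideal_gen_ker (T : nzRingType) (f : {rmorphism R -> T}) S x :
  (forall s, S s -> f s = 0) -> ideal_gen S x -> f x = 0.
Proof.
move=> fS; elim=> {x}; first exact: fS.
- exact: rmorph0.
- by move=> x y _ fx _ fy; rewrite rmorphD fx fy addr0.
- by move=> a x _ fx; rewrite rmorphM fx mulr0.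
- by move=> x a _ fx; rewrite rmorphM fx mul0r.
Qed.
End GeneratedIdeal.

(* The free algebra on I: the monoid algebra of the free monoid on I. Its
   operations are locked, since conversion tests that unfold them are slow. *)
HB.lock Definition freealg_mul (K : comNzRingType) (I : choiceType)
  (x y : {malg K[{fmonom I}]}) : {malg K[{fmonom I}]} := x * y.
HB.lock Definition freealg_scale (K : comNzRingType) (I : choiceType)
  (c : K) (x : {malg K[{fmonom I}]}) : {malg K[{fmonom I}]} := c *: x.

Section FreeAlgebra.
Context (K : comNzRingType) (I : choiceType).

Local Notation kI := {malg K[{fmonom I}]}.

Definition freealg : Type := kI.
HB.instance Definition _ := GRing.Zmodule.on freealg.

Let mulE (x y : freealg) : freealg_mul x y = x * y :> kI.
Proof. by rewrite unlock. Qed.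

Let mulA : associative (@freealg_mul K I).
Proof. by move=> x y z; rewrite !mulE mulrA. Qed.
Let mul1 : left_id (1 : kI) (@freealg_mul K I).
Proof. by move=> x; rewrite mulE mul1r. Qed.
Let mulx1 : right_id (1 : kI) (@freealg_mul K I).
Proof. by move=> x; rewrite mulE mulr1. Qed.
Let mulDl : left_distributive (@freealg_mul K I) +%R.
Proof. by move=> x y z; rewrite !mulE mulrDl. Qed.
Let mulDr : right_distributive (@freealg_mul K I) +%R.
Proof. by move=> x y z; rewrite !mulE mulrDr. Qed.
HB.instance Definition _ := GRing.Zmodule_isNzRing.Build freealg
  mulA mul1 mulx1 mulDl mulDr (oner_neq0 kI).

Lemma freealgME (x y : freealg) :
  x * y = @GRing.mul kI x y :> freealg.
Proof. exact: mulE. Qed.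

Lemma freealgZE (c : K) (x : freealg) : freealg_scale c x = c *: x :> kI.
Proof. by rewrite freealg_scale.unlock. Qed.

Let scaleA c d x :
  freealg_scale c (freealg_scale d x) = freealg_scale (c * d) x :> freealg.
Proof. by rewrite !freealgZE scalerA. Qed.
Let scale1 : left_id 1 (@freealg_scale K I).
Proof. by move=> x; rewrite freealgZE scale1r. Qed.
Let scaleDr : right_distributive (@freealg_scale K I) +%R.
Proof. by move=> c x y; rewrite !freealgZE scalerDr. Qed.
Let scaleDl x : {morph (@freealg_scale K I)^~ x : c d / c + d}.
Proof. by move=> c d; rewrite !freealgZE scalerDl. Qed.
HB.instance Definition _ := GRing.Zmodule_isLmodule.Build K freealg
  scaleA scale1 scaleDr scaleDl.

Let scaleAl (c : K) (x y : freealg) :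
  c *: (x * y) = @GRing.mul freealg (c *: x) y.
Proof.
by rewrite !freealgME /GRing.scale /= !freealgZE; apply: (@scalerAl K kI).
Qed.
HB.instance Definition _ := GRing.Lmodule_isLalgebra.Build K freealg scaleAl.

Let malg_scaleAr (c : K) (x y : kI) : c *: (x * y) = x * (c *: y).
Proof.
apply/malgP => k; rewrite (mcoeffZ c (x * y)) (mcoeffMl x y) mulr_sumr.
rewrite (@mcoeffMlw _ _ _ _ x (c *: y) k (finmap.fsubset_refl _) (msuppZ_le c y)).
apply: eq_bigr => k1 _; rewrite mulr_sumr; apply: eq_bigr => k2 _.
by rewrite mcoeffZ mulrnAr mulrCA.
Qed.
Let scaleAr (c : K) (x y : freealg) : c *: (x * y) = x * (c *: y).
Proof.
by rewrite !freealgME /GRing.scale /= !freealgZE; apply: malg_scaleAr.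
Qed.
HB.instance Definition _ := GRing.Lalgebra_isAlgebra.Build K freealg scaleAr.

Definition freevar (i : I) : freealg := << fmu i >>.

Section Eval.
Context (T : comNzRingType) (h : {rmorphism K -> T}) (f : I -> T).

Definition freemon_eval (m : {fmonom I}) : T := \prod_(i <- m) f i.

Lemma freemon_eval_mmorphism : mmorphism freemon_eval.
Proof.
split=> [x y|]; rewrite /freemon_eval ?fm1 ?big_nil //.
by rewrite fmM big_cat.
Qed.
HB.instance Definition _ := isMultiplicative.Build {fmonom I} T
  freemon_eval freemon_eval_mmorphism.

Definition freealg_eval : freealg -> T := mmap h freemon_eval.

Lemma freealg_eval_var i : freealg_eval (freevar i) = f i.
Proof. by rewrite /freealg_eval mmapU /= rmorph1 mul1r /freemon_eval fmU big_seq1. Qed.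

Lemma freealg_evalZ c x : freealg_eval (c *: x) = h c * freealg_eval x.
Proof. by rewrite {1}/GRing.scale /= freealgZE; apply: mmapZ. Qed.

HB.instance Definition _ := GRing.isZmodMorphism.Build freealg T freealg_eval
  (@mmap_is_additive _ _ _ h freemon_eval).

Lemma freealg_eval_is_monoid_morphism : monoid_morphism freealg_eval.
Proof.
have [M one] := @mmap_is_multiplicative _ _ _ h freemon_eval.
by split=> // x y; rewrite freealgME; apply: M.
Qed.
HB.instance Definition _ := GRing.isMonoidMorphism.Build freealg T freealg_eval
  freealg_eval_is_monoid_morphism.
End Eval.
End FreeAlgebra.

Definition yh_gens (n : nat) : Type :=
  ({i : nat | (0 < i < n)%N} + {j : nat | (0 < j <= n)%N})%type.
HB.instance Definition _ n := Choice.on (yh_gens n).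

(* Functions on nat, indexed from 1; they take the junk value 0 at an index out
   of range, which neither the relations nor the admissible words meet. *)
HB.lock Definition free_g (K : comNzRingType) (n i : nat) : freealg K (yh_gens n) :=
  if insub i is Some x then freevar K (inl x : yh_gens n) else 0.
HB.lock Definition free_t (K : comNzRingType) (n j : nat) : freealg K (yh_gens n) :=
  if insub j is Some x then freevar K (inr x : yh_gens n) else 0.

Section YokonumaTL.
Context (K : fieldType) (u : K) (d n : nat).

(* As t_{i+1}^d = 1, the power t_{i+1}^{-s} is t_{i+1}^{d-s} for 0 <= s < d. *)
Definition yh_e (A : algType K) (t : nat -> A) (i : nat) : A :=
  d%:R^-1 *: \sum_(s < d) t i ^+ s * t i.+1 ^+ (d - s).

Definition yh_gg (A : algType K) (g : nat -> A) (i j : nat) : A :=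
  1 + g i + g j + g i * g j + g j * g i + g i * g j * g i.

Local Notation g := (free_g K n).
Local Notation t := (free_t K n).
Local Notation e := (yh_e t).

Inductive yh_relation : freealg K (yh_gens n) -> freealg K (yh_gens n) -> Prop :=
| YH_comm i j : (0 < i < n)%N -> (0 < j < n)%N -> (i.+1 < j)%N || (j.+1 < i)%N ->
    yh_relation (g i * g j) (g j * g i)
| YH_braid i : (0 < i)%N -> (i.+1 < n)%N ->
    yh_relation (g i.+1 * g i * g i.+1) (g i * g i.+1 * g i)
| YH_quad i : (0 < i < n)%N ->
    yh_relation (g i ^+ 2) (1 + (u - 1) *: e i + (u - 1) *: (e i * g i))
| YH_tcomm i j : (0 < i <= n)%N -> (0 < j <= n)%N ->
    yh_relation (t i * t j) (t j * t i)
| YH_tord j : (0 < j <= n)%N -> yh_relation (t j ^+ d) 1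
| YH_gt i : (0 < i < n)%N -> yh_relation (g i * t i) (t i.+1 * g i)
| YH_gtS i : (0 < i < n)%N -> yh_relation (g i * t i.+1) (t i * g i)
| YH_gtcomm i j : (0 < i < n)%N -> (0 < j <= n)%N -> j != i -> j != i.+1 ->
    yh_relation (g i * t j) (t j * g i).

Definition yh_relator (r : freealg K (yh_gens n)) : Prop :=
  exists x y, yh_relation x y /\ r = x - y.

Definition yh_ideal (x : freealg K (yh_gens n)) : bool :=
  `[< ideal_gen yh_relator x >].

(* The one-dimensional representation g_i |-> -1, t_j |-> 1 shows that the
   ideals below are proper, as the algebra structures of MathComp require. *)
Let sign_rep : exists chi : {rmorphism freealg K (yh_gens n) -> K},
  [/\ forall c x, chi (c *: x) = c * chi x,
      forall i, (0 < i < n)%N -> chi (g i) = -1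
    & forall j, (0 < j <= n)%N -> chi (t j) = 1].
Proof.
exists (freealg_eval (@idfun K) (fun x : yh_gens n => if x is inl _ then -1 else 1)).
split=> [c x|i hi|j hj]; first exact: (@freealg_evalZ K (yh_gens n) K idfun).
  by rewrite unlock insubT /= freealg_eval_var.
by rewrite unlock insubT /= freealg_eval_var.
Qed.

Let sign_rep_yh : exists2 chi : {rmorphism freealg K (yh_gens n) -> K},
  forall i, (0 < i < n)%N -> chi (g i) = -1
  & forall r, yh_relator r -> chi r = 0.
Proof.
have [chi [chiZ chi_g chi_t]] := sign_rep; exists chi => // r.
have chi_e i : (0 < i < n)%N -> chi (e i) = d%:R^-1 * d%:R.
  move=> /andP[i0 ltin]; rewrite chiZ rmorph_sum.
  congr (_ * _); rewrite -[d in RHS]card_ord -sumr_const; apply: eq_bigr => s _.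
  by rewrite rmorphM !rmorphXn /= !chi_t ?expr1n ?mulr1 // i0 ltnW.
have tS i : (0 < i < n)%N -> (0 < i <= n)%N /\ (0 < i.+1 <= n)%N.
  by case/andP=> i0 ltin; rewrite i0 ltin ltnW.
case=> x [y [rel_xy ->]]; apply/eqP; rewrite rmorphB subr_eq0; apply/eqP.
case: rel_xy => {x y}.
- by move=> i j hi hj _; rewrite (rmorphM chi) (rmorphM chi) !chi_g.
- move=> i i0 ltin; have hi : (0 < i < n)%N by rewrite i0 ltnW.
  by do 4!rewrite (rmorphM chi); rewrite !chi_g.
- move=> i hi; rewrite expr2 (rmorphM chi) 2!(rmorphD chi) rmorph1.
  rewrite (chiZ _ (e i)) (chiZ _ (e i * g i)) (rmorphM chi) chi_e // chi_g //.
  by rewrite mulrN1 (mulrN1 (_ * _)) mulrN addrK opprK.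
- by move=> i j hi hj; do 2!rewrite (rmorphM chi); rewrite !chi_t.
- by move=> j hj; rewrite rmorphXn rmorph1 chi_t // expr1n.
- move=> i hi; have [? ?] := tS i hi.
  by do 2!rewrite (rmorphM chi); rewrite chi_g // !chi_t // mulrC.
- move=> i hi; have [? ?] := tS i hi.
  by do 2!rewrite (rmorphM chi); rewrite chi_g // !chi_t // mulrC.
- move=> i j hi hj _ _.
  by do 2!rewrite (rmorphM chi); rewrite chi_g // !chi_t // mulrC.
Qed.

Let yh_proper : ~ ideal_gen yh_relator 1.
Proof.
have [chi _ chi0] := sign_rep_yh; move=> /(ideal_gen_ker (f := chi) chi0)/eqP.
by rewrite rmorph1 oner_eq0.
Qed.

HB.instance Definition _ := isIdealr.Build _ yh_ideal
  (ideal_gen_idealr yh_proper).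
HB.instance Definition _ := isRightStable.Build _ yh_ideal
  (@ideal_gen_right _ yh_relator).

Definition yokonuma_hecke : algType K := algquot yh_ideal.

Definition yh_g (i : nat) : yokonuma_hecke := algpi yh_ideal (free_g K n i).
Definition yh_t (j : nat) : yokonuma_hecke := algpi yh_ideal (free_t K n j).

Definition ytl_relator (x : yokonuma_hecke) : Prop :=
  exists i j, [/\ (0 < i < n)%N, (0 < j < n)%N, (i == j.+1) || (j == i.+1)
    & x = yh_gg yh_g i j].

Definition ytl_ideal (x : yokonuma_hecke) : bool :=
  `[< ideal_gen ytl_relator x >].

Let ytl_proper : ~ ideal_gen ytl_relator 1.
Proof.
have [chi chi_g chi0] := sign_rep_yh.
have chi0I : {in yh_ideal, forall x, chi x = 0}.
  by move=> x /asboolP; apply: ideal_gen_ker chi0.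
have [chiY chiY_g] : exists chiY : {rmorphism yokonuma_hecke -> K},
    forall i, (0 < i < n)%N -> chiY (yh_g i) = -1.
  exists (algquot_lift chi0I) => i hi.
  exact: etrans (algquot_lift_pi _ _) (chi_g i hi).
have chiY0 x : ytl_relator x -> chiY x = 0.
  case=> i [j [hi hj _ ->]].
  rewrite /yh_gg !(rmorphD chiY) !(rmorphM chiY) rmorph1 !chiY_g //.
  by rewrite !mulrNN !mulr1 mulrN1 addrK subrK subrr.
move=> /(ideal_gen_ker (f := chiY) chiY0)/eqP.
by rewrite rmorph1 oner_eq0.
Qed.

HB.instance Definition _ := isIdealr.Build _ ytl_ideal
  (ideal_gen_idealr ytl_proper).
HB.instance Definition _ := isRightStable.Build _ ytl_ideal
  (@ideal_gen_right _ ytl_relator).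

Definition ytl : algType K := algquot ytl_ideal.

Definition ytl_g (i : nat) : ytl := algpi ytl_ideal (yh_g i).
Definition ytl_t (j : nat) : ytl := algpi ytl_ideal (yh_t j).

(* A pair (i, k) encodes the cycle g_i g_{i-1} ... g_{i-k}. *)
Definition cycle_indices (c : nat * nat) : seq nat :=
  [seq (c.1 - m)%N | m <- iota 0 c.2.+1].

(* The last conjunct reads 0 < i_1 - k_1 < ... < i_p - k_p, which also ensures
   that no truncation occurs in the subtractions i_j - k_j. *)
Definition cycles_admissible (w : seq (nat * nat)) : bool :=
  [&& path ltn 0 [seq c.1 | c <- w], all (fun c => c.1 < n)%N w
    & path ltn 0 [seq (c.1 - c.2)%N | c <- w]].

Definition ytl_word (a : 'I_n -> 'I_d) (w : seq (nat * nat)) : ytl :=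
  (\prod_(j < n) ytl_t j.+1 ^+ a j) *
  \prod_(c <- w) \prod_(i <- cycle_indices c) ytl_g i.

Definition ytl_Sigma (x : ytl) : Prop :=
  exists (a : 'I_n -> 'I_d) (w : seq (nat * nat)),
    cycles_admissible w /\ x = ytl_word a w.

End YokonumaTL.

Definition spans (K : nzRingType) (V : lmodType K) (S : V -> Prop) : Prop :=
  forall x : V, exists (m : nat) (c : 'I_m -> K) (v : 'I_m -> V),
    (forall i, S (v i)) /\ x = \sum_(i < m) c i *: v i.

Definition word_indices (w : seq (nat * nat)) : seq nat :=
  flatten [seq cycle_indices c | c <- w].

(* The field C(u), where C = R[i] for a model R of the real numbers. *)
Definition Cu (R : realType) : fieldType := {fraction {poly R[i]}}.
Definition Cu_u (R : realType) : Cu R := @tofrac {poly R[i]} 'X.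

(* Main.v *)
Require Import Defs.
From mathcomp Require Import all_boot all_order all_algebra.
From mathcomp Require Import reals boolp monalg.
From mathcomp Require Import zify.

(** The relations of the quotient let every word in the g_i be straightened, at
    the price of shorter words, whose coefficients lie in the commutative
    algebra T generated by the t_j.

    The g_i normalise T, so the algebra is filtered by the left T-spans of the
    words in the g_i of length at most l ([filt]), and a factor of a word
    may be rewritten within the filtration independently of its context
    ([filt_ctx]). The quadratic relation turns g_i g_i into words of length at
    most 1, and the vanishing of g_{i,j} turns g_i g_j g_i into words of length
    at most 2, for |i-j| = 1. Hence every factor g_i r g_j r' g_i collapses to
    shorter words as soon as the letters of r and r' commute with g_i
    ([filt_redex]).

    Cut a word without a factor i, j with j + 1 < i into maximal cycles: each
    starts at the last letter of the previous one or higher. If moreover the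
    word has no collapsing factor, then both the tops and the bottoms of its
    cycles strictly increase, since otherwise a letter would be repeated, either
    at once or with a single neighbour, and letters far from it, in between
    ([cycle_word_or_reducible]). So a word is of the desired form, or it drops in
    the filtration, or two of its adjacent commuting letters can be sorted.
    Sorting decreases a weight and keeps the length, so induction on the length,
    then on the weight, shows that the desired words span ([word_cycle_form]).

    The assertions on extreme indices only express that tops and bottoms of
    consecutive cycles strictly increase ([extreme_indices]). *)

Set Implicit Arguments.
Unset Strict Implicit.
Unset Printing Implicit Defensive.

Import GRing.Theory.

(** * Straightening words combinatorially *)

Definition far (i j : nat) : bool := (i.+1 < j) || (j.+1 < i).
Definition adjacent (i j : nat) : bool := (i == j.+1) || (j == i.+1).

(** The factors that collapse to shorter words: those on which the quadratic
    relation, or g_{i,j} = 0 after a commutation, can be applied. *)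
Inductive redex : seq nat -> Prop :=
| RedexSquare i : redex [:: i; i]
| RedexTL i j r r' : adjacent i j -> all (far i) r -> all (far i) r' ->
    redex (i :: r ++ j :: r' ++ [:: i]).

Definition descent (i j : nat) : bool := j.+1 < i.

Definition has_redex (w : seq nat) : Prop :=
  exists x y z, w = x ++ y ++ z /\ redex y.

Definition has_descent (w : seq nat) : Prop :=
  exists x i j z, w = x ++ [:: i; j] ++ z /\ descent i j.

Lemma has_redex_cons i w : has_redex w -> has_redex (i :: w).
Proof. by move=> [x [y [z [-> ry]]]]; exists (i :: x), y, z. Qed.

Lemma has_descent_cons i w : has_descent w -> has_descent (i :: w).
Proof. by move=> [x [a [b [z [-> ab]]]]]; exists (i :: x), a, b, z. Qed.

Lemma has_redex_prefix y z : redex y -> has_redex (y ++ z).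
Proof. by exists [::], y, z. Qed.

Lemma cycle_indices_cons i k :
  cycle_indices (i, k) = i :: [seq i - m | m <- iota 1 k].
Proof. by rewrite /cycle_indices /= subn0. Qed.

Lemma cycle_indicesS i k :
  cycle_indices (i.+1, k.+1) = i.+1 :: cycle_indices (i, k).
Proof.
rewrite cycle_indices_cons; congr cons; rewrite /cycle_indices.
by rewrite -[1]/(1 + 0) iotaDl -map_comp; apply: eq_map => m.
Qed.

Lemma word_indices_cons c w :
  word_indices (c :: w) = cycle_indices c ++ word_indices w.
Proof. by []. Qed.

(** The word is read from the right: its tail being already a product of
    admissible cycles, the new letter i is compared with the top i1 and the
    bottom i1 - k1 of the first of them. It opens a new cycle, extends that
    cycle to i1 + 1, or forms a descent or a collapsing factor. *)
Lemma cycle_word_or_reducible n w : all (fun i => 0 < i < n) w ->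
  [\/ exists2 cs, cycles_admissible n cs & word_indices cs = w,
      has_redex w | has_descent w].
Proof.
elim: w => [_|i w IH /=]; first by constructor 1; exists [::].
move=> /andP[/andP[i0 ltin] /IH{IH} []]; first last.
- by move/(has_descent_cons i); constructor 3.
- by move/(has_redex_cons i); constructor 2.
case=> [[|[i1 k1] cs]].
  move=> _ <-; constructor 1; exists [:: (i, 0)].
    by rewrite /cycles_admissible /= subn0 i0 ltin.
  by rewrite /word_indices /= /cycle_indices /= subn0.
move=> adm Ew.
case/and3P: adm => /= /andP[i10 path1] /andP[lti1n ltn1] /andP[b1 path2].
rewrite -Ew word_indices_cons {w Ew}.
case: (ltngtP i i1) => [lti|gti|->]; last first.
- rewrite cycle_indices_cons; constructor 2.
  exact: (has_redex_prefix _ (RedexSquare i1)).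
- case: (ltnP i1.+1 i) => [far_i|le_i].
    constructor 3; exists [::], i, i1; rewrite cycle_indices_cons /=.
    by eexists; split; first reflexivity.
  have {gti le_i} Ei : i = i1.+1 by lia.
  subst i; case: cs path1 ltn1 path2 => [|[i2 k2] cs] path1 ltn1 path2.
    constructor 1; exists [:: (i1.+1, k1.+1)]; last first.
      by rewrite word_indices_cons cycle_indicesS.
    by rewrite /cycles_admissible /= ltin subSS b1.
  case: (ltnP i1.+1 i2) => [lt2|le2].
    constructor 1; exists [:: (i1.+1, k1.+1), (i2, k2) & cs]; last first.
      by rewrite word_indices_cons cycle_indicesS.
    move: path1 ltn1 path2; rewrite /cycles_admissible /= lt2 ltin subSS b1 /=.
    by move=> /andP[_ ->] /andP[-> ->] /andP[-> ->].
  (* the second cycle has the same top as the extended first one *)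
  have {le2} E2 : i2 = i1.+1 by move: path1 => /=; lia.
  subst i2; constructor 2.
  rewrite word_indices_cons !cycle_indices_cons.
  set r := map _ _; set z := map _ _; set y := word_indices _.
  rewrite (_ : _ :: _ = (i1.+1 :: [::] ++ i1 :: r ++ [:: i1.+1]) ++ (z ++ y)); last first.
    by rewrite /= -catA.
  apply/has_redex_prefix/RedexTL => //; first by rewrite /adjacent eqxx.
  apply/allP => j /mapP[m]; rewrite mem_iota /far => hm ->.
  by lia.
case: (ltnP i (i1 - k1)) => [ltb|geb].
  constructor 1; exists [:: (i, 0), (i1, k1) & cs]; last first.
    by rewrite !word_indices_cons /cycle_indices /= subn0.
  rewrite /cycles_admissible /= i0 ltin lti path1 lti1n ltn1 subn0 i0 ltb path2 //.
(* i lies in the first cycle below its top: it encloses i + 1 between two i *)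
constructor 2.
have [p Ei1] : exists p, i1 = i + p.+1 by exists (i1 - i).-1; lia.
have [q Ek1] : exists q, k1 = p.+1 + q by exists (k1 - p.+1); lia.
have -> : cycle_indices (i1, k1) =
   [seq i1 - m | m <- iota 0 p] ++ [:: i.+1; i] ++ [seq i1 - m | m <- iota p.+2 q].
  rewrite /cycle_indices (_ : (i1, k1).2.+1 = p + (2 + q)); last first.
    by rewrite /= Ek1; lia.
  rewrite iotaD map_cat; congr (_ ++ _) => /=.
  by congr [:: _, _ & _]; rewrite ?Ei1; lia.
rewrite -!catA /=; set r := map _ _; set z := map _ _; set y := word_indices _.
rewrite (_ : _ :: _ = (i :: r ++ i.+1 :: [::] ++ [:: i]) ++ (z ++ y)); last first.
  by rewrite /= -!catA.
apply/has_redex_prefix/RedexTL => //; first by rewrite /adjacent eqxx orbT.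
apply/allP => j /mapP[m]; rewrite mem_iota /far => hm ->.
by lia.
Qed.

(** Each letter weighs its value times its distance to the end of the word, so
    that moving the larger of two adjacent letters to the right is a gain. *)
Fixpoint weight (w : seq nat) : nat :=
  if w is i :: w' then i * size w + weight w' else 0.

Lemma weight_swap x i j z : descent i j ->
  weight (x ++ [:: j; i] ++ z) < weight (x ++ [:: i; j] ++ z).
Proof.
rewrite /descent; elim: x => [|k x IH] /= hij; first by lia.
by rewrite !size_cat ltn_add2l; apply: IH.
Qed.

(** * Extreme indices of an admissible word *)

Lemma mem_cycle_indices i c : c.2 <= c.1 ->
  i \in cycle_indices c = (c.1 - c.2 <= i <= c.1).
Proof.
move=> le; apply/mapP/idP => [[m]|].
  by rewrite mem_iota => hm ->; lia.
by move=> hi; exists (c.1 - i); rewrite ?mem_iota; lia.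
Qed.

(** Bottoms are positive although subtraction is truncated, so k < i for each
    cycle (i, k). *)
Lemma cycles_admissibleP n w : cycles_admissible n w ->
  [/\ pairwise (relpre (fun c => c.1) ltn) w,
      pairwise (relpre (fun c => c.1 - c.2) ltn) w
    & all (fun c : nat * nat => c.2 < c.1) w].
Proof.
move=> /and3P[/path_sorted s1 _ p2].
split.
- by rewrite -pairwise_map -(sorted_pairwise ltn_trans).
- by rewrite -pairwise_map -(sorted_pairwise ltn_trans) (path_sorted p2).
- move: (order_path_min ltn_trans p2); rewrite all_map.
  by apply: sub_all => c /=; rewrite subn_gt0.
Qed.

Lemma word_indicesP i w :
  reflect (exists2 c, c \in w & i \in cycle_indices c) (i \in word_indices w).
Proof. exact: flatten_mapP. Qed.

Lemma extreme_indices n c1 w : cycles_admissible n (c1 :: w) ->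
    let cp := last c1 w in
    [/\ (forall i, i \in word_indices (c1 :: w) -> (i <= cp.1)%N),
        cp.1 \in cycle_indices cp,
        cp.1 \notin word_indices (belast c1 w)
      & [/\ (forall i, i \in word_indices (c1 :: w) -> (c1.1 - c1.2 <= i)%N),
            (c1.1 - c1.2)%N \in cycle_indices c1
          & (c1.1 - c1.2)%N \notin word_indices w]].
Proof.
move=> /cycles_admissibleP[top bot pos] cp.
have nontr c : c \in c1 :: w -> c.2 <= c.1 by move=> /(allP pos)/ltnW.
have cpw : cp \in c1 :: w by apply: mem_last.
have top_lt c : c \in belast c1 w -> c.1 < cp.1.
  by move: top; rewrite lastI pairwise_rcons => /andP[/allP h _] /h.
have bot_lt c : c \in w -> c1.1 - c1.2 < c.1 - c.2.
  by move: bot => /andP[/allP h _] /h.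
have top_le c : c \in c1 :: w -> c.1 <= cp.1.
  by rewrite lastI mem_rcons inE => /predU1P[->//|/top_lt/ltnW].
have bot_le c : c \in c1 :: w -> c1.1 - c1.2 <= c.1 - c.2.
  by rewrite inE => /predU1P[->//|/bot_lt/ltnW].
have c1w : c1 \in c1 :: w by rewrite mem_head.
split; last split.
- move=> i /word_indicesP[c cw]; rewrite mem_cycle_indices ?nontr // => /andP[_ h].
  exact: leq_trans h (top_le c cw).
- by rewrite mem_cycle_indices ?nontr // leq_subr leqnn.
- apply/word_indicesP => -[c cw]; rewrite mem_cycle_indices.
    by rewrite leqNgt [cp.1 <= _]leqNgt top_lt // andbF.
  by apply: nontr; rewrite lastI mem_rcons inE cw orbT.
- move=> i /word_indicesP[c cw]; rewrite mem_cycle_indices ?nontr // => /andP[h _].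
  exact: leq_trans (bot_le c cw) h.
- by rewrite mem_cycle_indices ?nontr // leq_subr leqnn.
- apply/word_indicesP => -[c cw]; rewrite mem_cycle_indices; last first.
    by apply: nontr; rewrite inE cw orbT.
  by rewrite leqNgt bot_lt.
Qed.

(** * Linear spans in infinite dimension *)

Section LinearSpan.
Local Open Scope ring_scope.
Context (K : nzRingType) (V : lmodType K).
Implicit Types (S : V -> Prop) (x y : V).

Inductive lspan S : V -> Prop :=
| LSpan0 : lspan S 0
| LSpanZD a x y : S x -> lspan S y -> lspan S (a *: x + y).

Lemma lspan_gen S x : S x -> lspan S x.
Proof.
move=> Sx; rewrite -[x]scale1r -[_ *: _]addr0.
by apply: LSpanZD => //; exact: LSpan0.
Qed.

Lemma lspanD S x y : lspan S x -> lspan S y -> lspan S (x + y).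
Proof.
elim=> [|a x' y' Sx _ IH]; first by rewrite add0r.
by move=> /IH Sy; rewrite -addrA; constructor.
Qed.

Lemma lspanZ S a x : lspan S x -> lspan S (a *: x).
Proof.
elim=> [|b x' y' Sx _ IH]; first by rewrite scaler0; constructor.
by rewrite scalerDr scalerA; constructor.
Qed.

Lemma lspanN S x : lspan S x -> lspan S (- x).
Proof. by rewrite -scaleN1r; apply: lspanZ. Qed.

Lemma lspan_sum (I : Type) (r : seq I) S (F : I -> V) :
  (forall i, lspan S (F i)) -> lspan S (\sum_(i <- r) F i).
Proof. by move=> SF; elim/big_ind: _ => // *; [constructor | apply: lspanD]. Qed.

Lemma lspan_bind S S' x :
  (forall y, S y -> lspan S' y) -> lspan S x -> lspan S' x.
Proof.
move=> sub; elim=> [|a x' y' /sub Sx _ Sy]; first by constructor.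
by apply: lspanD => //; apply: lspanZ.
Qed.

(** [spans] asks for the terms of a combination as families over an initial
    segment of the integers; a new term takes index 0. *)
Lemma lspan_spans S : (forall x, lspan S x) -> spans S.
Proof.
move=> full x; elim: {x}(full x) => [|a x y Sx _ [m [c [v [Sv ->]]]]].
  by exists 0, (fun=> 0), (fun=> 0); split; [case | rewrite big_ord0].
exists m.+1, (fun i => oapp c a (unlift ord0 i)).
exists (fun i => oapp v x (unlift ord0 i)).
split=> [i|]; first by case: (unlift ord0 i).
rewrite big_ord_recl unlift_none /=; congr (_ + _).
by apply: eq_bigr => i _; rewrite liftK.
Qed.
End LinearSpan.

Section LinearSpanAlgebra.
Local Open Scope ring_scope.
Context (K : nzRingType) (A : algType K).

Lemma lspan_mull (S S' : A -> Prop) a x :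
  (forall y, S y -> lspan S' (a * y)) -> lspan S x -> lspan S' (a * x).
Proof.
move=> sub; elim=> [|c x' y' /sub Sx _ Sy]; first by rewrite mulr0; constructor.
by rewrite mulrDr -scalerAr; apply: lspanD => //; apply: lspanZ.
Qed.

Lemma lspan_mulr (S S' : A -> Prop) a x :
  (forall y, S y -> lspan S' (y * a)) -> lspan S x -> lspan S' (x * a).
Proof.
move=> sub; elim=> [|c x' y' /sub Sx _ Sy]; first by rewrite mul0r; constructor.
by rewrite mulrDl -scalerAl; apply: lspanD => //; apply: lspanZ.
Qed.
End LinearSpanAlgebra.

(** * Straightening in an algebra satisfying the relations *)

Section Straightening.
Local Open Scope ring_scope.
Context (K : fieldType) (u : K) (d n : nat) (A : algType K).
Context (g t : nat -> A).

(** The defining relations. The braid relation follows from the last one: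
    g_{i,j} - g_{j,i} = g_i g_j g_i - g_j g_i g_j, and both terms vanish. *)
Record ytl_family : Prop := YTLFamily {
  fam_comm i j : (0 < i < n)%N -> (0 < j < n)%N -> far i j ->
    g i * g j = g j * g i;
  fam_quad i : (0 < i < n)%N ->
    g i ^+ 2 = 1 + (u - 1) *: yh_e d t i + (u - 1) *: (yh_e d t i * g i);
  fam_tcomm i j : (0 < i <= n)%N -> (0 < j <= n)%N -> t i * t j = t j * t i;
  fam_tord j : (0 < j <= n)%N -> t j ^+ d = 1;
  fam_gt i : (0 < i < n)%N -> g i * t i = t i.+1 * g i;
  fam_gtS i : (0 < i < n)%N -> g i * t i.+1 = t i * g i;
  fam_gtcomm i j : (0 < i < n)%N -> (0 < j <= n)%N -> j != i -> j != i.+1 ->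
    g i * t j = t j * g i;
  fam_tl i j : (0 < i < n)%N -> (0 < j < n)%N -> adjacent i j ->
    yh_gg g i j = 0
}.

Context (fam : ytl_family).

Let gi i := (0 < i < n)%N.
Let ti j := (0 < j <= n)%N.
Let gword (w : seq nat) : A := \prod_(i <- w) g i.
Let tword (s : seq nat) : A := \prod_(j <- s) t j.

Let gword_cons i w : gword (i :: w) = g i * gword w.
Proof. exact: big_cons. Qed.
Let tword_cons i w : tword (i :: w) = t i * tword w.
Proof. exact: big_cons. Qed.
Let gword_cat x y : gword (x ++ y) = gword x * gword y.
Proof. exact: big_cat. Qed.

(** Words are lists of letters on both sides. The letters t_j are free of
    charge: only the g_i count for the length. *)
Definition filt_word l (x : A) : Prop := exists s w,
  [/\ all ti s, all gi w, (size w <= l)%N & x = tword s * gword w].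

(** The l-th step of the length filtration. *)
Definition filt l : A -> Prop := lspan (filt_word l).

Lemma filt_word_gword l w : all gi w -> (size w <= l)%N -> filt l (gword w).
Proof.
by move=> hw hl; apply: lspan_gen; exists [::], w; rewrite /tword big_nil mul1r.
Qed.

Lemma filt_leq l m x : (l <= m)%N -> filt l x -> filt m x.
Proof.
move=> lm; apply: lspan_bind => y [s [w [hs hw hl ->]]].
by apply: lspan_gen; exists s, w; rewrite (leq_trans hl).
Qed.

Lemma filt_t l j x : ti j -> filt l x -> filt l (t j * x).
Proof.
move=> hj; apply: lspan_mull => y [s [w [hs hw hl ->]]].
by apply: lspan_gen; exists (j :: s), w; rewrite /= hj tword_cons mulrA.
Qed.

Lemma filt_e l i x : gi i -> filt l x -> filt l (yh_e d t i * x).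
Proof.
move=> /andP[i0 ltin] hx; rewrite -scalerAl; apply: lspanZ.
rewrite mulr_suml; apply: lspan_sum => s.
have hX j m y : ti j -> filt l y -> filt l (t j ^+ m * y).
  move=> hj hy; elim: m => [|m IH]; first by rewrite mul1r.
  by rewrite exprS -mulrA; apply: filt_t.
by rewrite -mulrA; apply/hX/hX => //; rewrite /ti ?i0 ?ltin // ltnW.
Qed.

Let swap i j := if j == i then i.+1 else if j == i.+1 then i else j.

Lemma g_t i j : gi i -> ti j -> g i * t j = t (swap i j) * g i.
Proof.
rewrite /swap => hi hj; have [->|ne] := eqVneq j i; first exact: (fam_gt fam).
have [->|neS] := eqVneq; first exact: (fam_gtS fam).
exact: (fam_gtcomm fam).
Qed.

Lemma g_tword i s : gi i -> all ti s ->
  g i * tword s = tword (map (swap i) s) * g i.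
Proof.
move=> hi; elim: s => [|j s IH] /=; first by rewrite /tword !big_nil mulr1 mul1r.
case/andP=> hj /IH{}IH; rewrite !tword_cons mulrA g_t //.
by rewrite -mulrA IH mulrA.
Qed.

Lemma filt_gl l i x : gi i -> filt l x -> filt l.+1 (g i * x).
Proof.
move=> hi; apply: lspan_mull => y [s [w [hs hw hl ->]]].
apply: lspan_gen; exists (map (swap i) s), (i :: w).
rewrite /= hi hw ltnS hl gword_cons !mulrA g_tword //; split=> //.
rewrite all_map; apply/allP => j /(allP hs); move: hi; rewrite /gi /ti /swap /=.
by do 2?case: eqP => _; lia.
Qed.

Lemma filt_gr l i x : gi i -> filt l x -> filt l.+1 (x * g i).
Proof.
move=> hi; apply: lspan_mulr => y [s [w [hs hw hl ->]]].
apply: lspan_gen; exists s, (rcons w i).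
by rewrite all_rcons hi size_rcons -cats1 gword_cat /gword big_seq1 mulrA.
Qed.

(** Each letter of the context costs one step of the filtration: on the right it
    only lengthens the words, on the left g_i t_j = t_{s_i(j)} g_i brings the
    coefficients back in front. *)
Lemma filt_ctx l x y z : all gi (x ++ y ++ z) -> filt l (gword y) ->
  filt (size x + l + size z) (gword (x ++ y ++ z)).
Proof.
rewrite !all_cat => /and3P[hx _ hz] hy; rewrite !gword_cat.
have {hy} : filt (l + size z) (gword y * gword z).
  elim/last_ind: z hz => [|z i IH]; first by rewrite /gword big_nil mulr1 addn0.
  rewrite all_rcons => /andP[hi /IH{}IH].
  rewrite -cats1 gword_cat mulrA size_cat addn1 addnS /gword big_seq1.
  exact: filt_gr.
elim: x hx => [|i x IH] /=; first by rewrite /gword big_nil mul1r.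
move=> /andP[hi /IH{}IH] /IH{}IH; rewrite gword_cons -mulrA !addSn.
exact: filt_gl.
Qed.

Lemma gword_far i w : gi i -> all gi w -> all (far i) w ->
  g i * gword w = gword w * g i.
Proof.
move=> hi /allP hw /allP hf; rewrite /gword big_seq.
by apply: commr_prod => j jw; apply: (fam_comm fam) => //; [apply: hw | apply: hf].
Qed.

(** The letters commuting with g_i leave the factor on both sides, which leaves
    g_i g_i, or g_i g_j g_i; the latter is minus the sum of the shorter terms
    of g_{i,j}. *)
Lemma filt_redex y : redex y -> all gi y -> filt (size y).-1 (gword y).
Proof.
case=> {y} [i|i j r r' adj far_r far_r'].
  rewrite /= => /andP[hi _].
  rewrite gword_cons /gword big_seq1 -expr2 (fam_quad fam) //.
  have s1 : filt 1 1.
    by have := @filt_word_gword 1 [::]; rewrite /gword big_nil; apply.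
  have sg : filt 1 (g i).
    by have := @filt_word_gword 1 [:: i]; rewrite /gword big_seq1 /= hi; apply.
  have e1 := filt_e hi s1; rewrite mulr1 in e1.
  by do 2?apply: lspanD => //; apply: lspanZ => //; apply: filt_e.
rewrite /= !all_cat /= all_cat /= andbT => /and5P[hi hr hj hr' _].
have -> : gword (i :: r ++ j :: r' ++ [:: i]) = gword (r ++ [:: i; j; i] ++ r').
  rewrite gword_cons !gword_cat gword_cons gword_cat mulrA gword_far //.
  rewrite /gword !big_cons big_nil mulr1 -!/(gword _) -!mulrA; do 3!congr (_ * _).
  by rewrite gword_far.
apply: (@filt_leq (size r + 2 + size r')).
  by rewrite !size_cat /= size_cat /=; lia.
apply: filt_ctx; first by rewrite !all_cat /= hr hi hj hr'.
have -> : gword [:: i; j; i] = - (gword [::] + gword [:: i] + gword [:: j]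
    + gword [:: i; j] + gword [:: j; i]).
  apply/eqP; rewrite -addr_eq0 addrC; apply/eqP.
  rewrite -[RHS](fam_tl fam hi hj adj).
  by rewrite /yh_gg /gword !big_cons big_nil !mulr1 mulrA.
by apply/lspanN; do 4?[apply: lspanD]; apply: filt_word_gword; rewrite /= ?hi ?hj.
Qed.

Definition cycle_form (x : A) : Prop := exists (a : 'I_n -> 'I_d) w,
  cycles_admissible n w /\
  x = (\prod_(j < n) t j.+1 ^+ a j) *
      \prod_(c <- w) \prod_(i <- cycle_indices c) g i.

Lemma t_monomial j (a : nat -> nat) m : (m <= n)%N -> (0 < j <= m)%N ->
  t j * \prod_(k < m) t k.+1 ^+ a k = \prod_(k < m) t k.+1 ^+ ((k.+1 == j) + a k)%N.
Proof.
elim: m => [|m IH] lemn; first by case: j.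
rewrite (leq_eqVlt j) ltnS => /andP[j0 /orP[/eqP Ej|lejm]]; rewrite !big_ord_recr /=.
  subst j; rewrite mulrA; set p := \prod_(_ < _) _; set q := \prod_(_ < _) _.
  have -> : q = p.
    by apply: eq_bigr => k _; rewrite eqSS (ltn_eqF (ltn_ord k)).
  have -> : t m.+1 * p = p * t m.+1.
    apply: commr_prod => k _; apply: commrX; apply: (fam_tcomm fam) => //=.
    by rewrite (leq_trans _ lemn) // leqW.
  by rewrite -mulrA -exprS eqxx.
rewrite mulrA IH ?j0 // ?(ltnW lemn) //; congr (_ * _).
by rewrite gtn_eqF.
Qed.

Lemma tword_monomial s : (0 < d)%N -> all ti s ->
  exists a : 'I_n -> 'I_d, tword s = \prod_(j < n) t j.+1 ^+ a j.
Proof.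
move=> d0 hs; have [a ->] : exists a : nat -> nat,
    tword s = \prod_(j < n) t j.+1 ^+ a j.
  elim: s hs => [|j s IH] /=.
    by exists (fun=> 0%N); rewrite /tword big_nil big1.
  move=> /andP[hj /IH[a Ea]]; exists (fun k => (k.+1 == j) + a k)%N.
  by rewrite tword_cons Ea t_monomial.
exists (fun j => Ordinal (ltn_pmod (a j) d0)).
apply: eq_bigr => j _ /=; rewrite {1}(divn_eq (a j) d) exprD mulnC exprM.
by rewrite (fam_tord fam) ?expr1n ?mul1r // ltn_ord.
Qed.

(** Nested induction, on the length for words that collapse and on the weight for
    words with a descent. The quantification over s matters, since
    collapsing changes the coefficient in the t_j. *)
Lemma word_cycle_form s w : (0 < d)%N -> all ti s -> all gi w ->
  lspan cycle_form (tword s * gword w).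
Proof.
move=> d0; have [N] := ubnP (size w); elim: N s w => // N IHN s w.
have [M] := ubnP (weight w); elim: M s w => // M IHM s w wM wN hs hw.
have [[cs adm Ew]|[x [y [z [Ew ry]]]]|[x [i [j [z [Ew dij]]]]]] :=
  cycle_word_or_reducible hw.
- have [a ->] := tword_monomial d0 hs; apply: lspan_gen; exists a, cs; split=> //.
  by congr (_ * _); rewrite -Ew /gword /word_indices big_flatten big_map.
- have hy : all gi y by move: hw; rewrite Ew !all_cat => /and3P[].
  have y0 : (0 < size y)%N by case: ry.
  have : filt N.-1 (tword s * gword w).
    have sw : filt N.-1 (gword w).
      rewrite Ew; apply: filt_leq (filt_ctx _ (filt_redex ry hy)); last first.
        by rewrite -Ew.
      by move: wN; rewrite Ew !size_cat; lia.
    elim: (s) hs => [|j s' IH] /=; first by rewrite /tword big_nil mul1r.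
    by move=> /andP[hj /IH{}IH]; rewrite tword_cons -mulrA; apply: filt_t.
  apply: lspan_bind => _ [s' [w' [hs' hw' sz ->]]]; apply: IHN => //.
  by move: wN sz; rewrite Ew !size_cat; lia.
- move: wM wN hw; rewrite Ew => wM wN hw.
  have [hi hj] : gi i /\ gi j.
    by move: hw; rewrite !all_cat /= => /and3P[_ /and3P[]].
  have -> : gword (x ++ [:: i; j] ++ z) = gword (x ++ [:: j; i] ++ z).
    rewrite !gword_cat; congr (_ * (_ * _)).
    rewrite /gword !big_cons big_nil !mulr1.
    apply: (fam_comm fam) => //.
    by move: dij; rewrite /far /descent => ->; rewrite orbT.
  apply: IHM => //.
  + exact: leq_trans (weight_swap _ _ dij) wM.
  + by move: wN; rewrite !size_cat.
  + by move: hw; rewrite !all_cat /= hi hj.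
Qed.

Lemma filt_cycle_form l x : (0 < d)%N -> filt l x -> lspan cycle_form x.
Proof.
by move=> d0; apply: lspan_bind => _ [s [w [hs hw _ ->]]]; apply: word_cycle_form.
Qed.
End Straightening.

(** * Generation of the Yokonuma--Temperley--Lieb algebra *)

Section FreeAlgebraWords.
Local Open Scope ring_scope.

Lemma freealg_words (K : comNzRingType) (I : choiceType) (x : freealg K I) :
  lspan (fun y => exists s : seq I, y = \prod_(i <- s) freevar K i) x.
Proof.
rewrite [x](monalgE (x : {malg K[{fmonom I}]})).
apply: lspan_sum => m; set c := mcoeff _ _.
have -> : << c *g m >> = c *: (<< m >> : freealg K I).
  rewrite {1}/GRing.scale /= freealgZE; apply/malgP => k.
  by rewrite mcoeffZ !mcoeffU mulrnAr mulr1.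
apply/lspanZ/lspan_gen; exists (fmonom_val m).
rewrite {c}; case: m => s /=; elim: s => [|i s IH].
  by rewrite big_nil -fmoneE.
rewrite big_cons -IH freealgME /freevar.
have -> : FMonom (i :: s) = fmmul (fmu i) (FMonom s) by rewrite fmmulE fmuE.
by rewrite malgM_def fgmulUU mulr1.
Qed.

End FreeAlgebraWords.

Section Presentation.
Local Open Scope ring_scope.
Context (K : fieldType) (u : K) (d n : nat).

Let yh_eq x y : @yh_relation K u d n x y ->
  algpi (@yh_ideal K u d n) x = algpi (@yh_ideal K u d n) y.
Proof.
move=> r; apply/algpiP; rewrite unfold_in; apply/asboolP; apply: IdealGen.
by exists x, y.
Qed.

Let pi (x : freealg K (yh_gens n)) : ytl u d n :=
  algpi (@ytl_ideal K u d n) (algpi (@yh_ideal K u d n) x).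

Let piM x y : pi (x * y) = pi x * pi y.
Proof. by rewrite /pi !rmorphM. Qed.
Let piD x y : pi (x + y) = pi x + pi y.
Proof. by rewrite /pi !rmorphD. Qed.
Let pi1 : pi 1 = 1.
Proof. by rewrite /pi !rmorph1. Qed.
Let piZ c x : pi (c *: x) = c *: pi x.
Proof. by rewrite /pi !linearZ. Qed.
Let piX x m : pi (x ^+ m) = pi x ^+ m.
Proof. by rewrite /pi !rmorphXn. Qed.
Let pi_e i : pi (yh_e d (free_t K n) i) = yh_e d (ytl_t u d n) i.
Proof.
rewrite [LHS]piZ /yh_e; congr (_ *: _); rewrite /pi 2!rmorph_sum.
by apply: eq_bigr => s _; rewrite [LHS]piM !piX.
Qed.
Let pi_eq x y : @yh_relation K u d n x y -> pi x = pi y.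
Proof. by rewrite /pi => /yh_eq ->. Qed.

Lemma ytl_is_family : ytl_family u d n (ytl_g u d n) (ytl_t u d n).
Proof.
have pig i : ytl_g u d n i = pi (free_g K n i) by [].
have pit i : ytl_t u d n i = pi (free_t K n i) by [].
split.
- by move=> *; rewrite ?pig ?pit -!piM; apply/pi_eq/YH_comm.
- move=> i hi; rewrite pig -piX (pi_eq (YH_quad _ _ _)) // !piD.
  by rewrite [X in _ + X + _]piZ [X in _ + X]piZ piM pi1 pi_e.
- by move=> *; rewrite ?pig ?pit -!piM; apply/pi_eq/YH_tcomm.
- by move=> *; rewrite ?pig ?pit -piX -pi1; apply/pi_eq/YH_tord.
- by move=> *; rewrite ?pig ?pit -!piM; apply/pi_eq/YH_gt.
- by move=> *; rewrite ?pig ?pit -!piM; apply/pi_eq/YH_gtS.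
- by move=> *; rewrite ?pig ?pit -!piM; apply/pi_eq/YH_gtcomm.
- move=> i j hi hj adj.
  rewrite -[LHS](_ : algpi (@ytl_ideal K u d n) (yh_gg (yh_g u d n) i j) = _);
    last first.
    by rewrite /yh_gg !rmorphD !rmorphM rmorph1.
  rewrite -(rmorph0 (algpi (@ytl_ideal K u d n))); apply/algpiP.
  rewrite subr0 unfold_in; apply/asboolP/IdealGen.
  by exists i, j.
Qed.

Lemma filt_generator_word (s : seq (yh_gens n)) :
  filt n (ytl_g u d n) (ytl_t u d n) (size s) (pi (\prod_(x <- s) freevar K x)).
Proof.
elim: s => [|x s IH].
  rewrite big_nil pi1; have := @filt_word_gword K n _ (ytl_g u d n) (ytl_t u d n) 0 [::].
  by rewrite big_nil; apply.
rewrite big_cons piM; case: x => [[i hi]|[j hj]].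
  have -> : pi (freevar K (inl (exist _ i hi) : yh_gens n)) = ytl_g u d n i.
    by rewrite /ytl_g /yh_g free_g.unlock insubT.
  exact: (filt_gl ytl_is_family).
have -> : pi (freevar K (inr (exist _ j hj) : yh_gens n)) = ytl_t u d n j.
  by rewrite /ytl_t /yh_t free_t.unlock insubT.
apply: filt_leq (filt_t hj IH); exact: leqnSn.
Qed.

Lemma ytl_Sigma_spans : (0 < d)%N -> spans (@ytl_Sigma K u d n).
Proof.
move=> d0; apply: lspan_spans => x.
rewrite -[x]algreprK -[algrepr x]algreprK -/(pi _).
elim: (freealg_words (algrepr (algrepr x))) => [|c y z [s ->] _ Sz].
  by rewrite /pi !rmorph0; constructor.
rewrite piD piZ; apply: lspanD => //; apply: lspanZ.
exact: (filt_cycle_form ytl_is_family d0 (filt_generator_word s)).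
Qed.
End Presentation.

Theorem proposition4 (R : realType) (d n : nat) (hd : (1 <= d)%N) (hn : (3 <= n)%N) :
  spans (@ytl_Sigma (Cu R) (Cu_u R) d n) /\
  (forall (c1 : nat * nat) (w : seq (nat * nat)),
    cycles_admissible n (c1 :: w) ->
    let cp := last c1 w in
    [/\ (* the highest index is i_p, and it occurs in the rightmost cycle only *)
        (forall i, i \in word_indices (c1 :: w) -> (i <= cp.1)%N),
        cp.1 \in cycle_indices cp,
        cp.1 \notin word_indices (belast c1 w)
      & (* the lowest index is i_1 - k_1, and it occurs in the leftmost cycle only *)
        [/\ (forall i, i \in word_indices (c1 :: w) -> (c1.1 - c1.2 <= i)%N),
            (c1.1 - c1.2)%N \in cycle_indices c1
          & (c1.1 - c1.2)%N \notin word_indices w]]).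
Proof.
split; first exact: ytl_Sigma_spans.
exact: extreme_indices.
Qed.
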